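(* Let $d:(0,\varepsilon)\to(0,\varepsilon')$ be positive and tend to $0$ as $x\to0^+$. Let $\phi$ and $\psi$ be orientation-preserving real-analytic diffeomorphism germs at $0\in\mathbb R$, fixing $0$, and put $\widetilde d=\psi\circ d\circ\phi^{-1}$ (as a germ at $0^+$). Then the following are equivalent. (1) $d$ has a convergent natural-support generalized power-series representation. (2) $\widetilde d$ has a convergent natural-support generalized power-series representation. (3) $D_d$ has a convergent log-free Dulac representation. (4) $D_{\widetilde d}$ has a convergent log-free Dulac representation.
   Context: A set $A\subseteq\mathbb R$ is natural if $A\cap(-\infty,B]$ is finite for every $B\in\mathbb R$. A natural-support generalized power series is a formal sum $F(X)=\sum_{\alpha\in A}c_\alpha X^\alpha$ with $c_\alpha\in\mathbb R$ and $A\subseteq[0,\infty)$ natural. It is convergent if $\sum_\alpha|c_\alpha|\rho^\alpha<\infty$ for some $\rho>0$; then it defines a function $F(x)=\sum c_\alpha x^\alpha$ for $0<x\le\rho$. A germ $f$ at $0^+$ has a convergent natural-support generalized power-series representation if $f(x)=F(x)$ for all sufficiently small $x>0$ for some such convergent $F$. For a positive germ $f$ with $f(x)\to0$ as $x\to0^+$, put $\zeta=-\log x$ and $D_f(\zeta):=-\log f(e^{-\zeta})$ for large real $\zeta$. A convergent log-free Dulac representation of $D_f$ is an identity $D_f(\zeta)=\lambda\zeta+c+L(e^{-\zeta})$ valid for all sufficiently large real $\zeta$, where $\lambda>0$, $c\in\mathbb R$, and $L$ is a convergent natural-support generalized power series with $L(0)=0$ (zero constant term). *)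

(* Defs.v *)
From HB Require Import structures.
From mathcomp Require Import all_boot all_order all_algebra.
From mathcomp Require Import all_classical all_reals all_analysis.

Set Implicit Arguments.
Unset Strict Implicit.
Unset Printing Implicit Defensive.

Import Order.TTheory GRing.Theory Num.Theory.
Import numFieldNormedType.Exports.

Local Open Scope classical_set_scope.
Local Open Scope ring_scope.

Definition natural_set (R : realType) (A : set R) : Prop :=
  forall B : R, finite_set (A `&` [set x | x <= B]).

Definition coef_support (R : realType) (c : R -> R) : set R :=
  [set a | c a != 0].

(* The formal sum \sum_(a in A) c_a X^a is encoded by its coefficient function,
   extended by 0 outside A, so that A may be taken to be its support. *)
Record gpseries (R : realType) := GPSeries {
  gps_coef :> R -> R;
  gps_support_ge0 : coef_support gps_coef `<=` [set a | 0 <= a];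
  gps_support_natural : natural_set (coef_support gps_coef) }.

Definition gps_convergent (R : realType) (F : gpseries R) : Prop :=
  exists2 rho : R, 0 < rho &
    (\esum_(a in coef_support F) (`|F a| * rho `^ a)%:E < +oo)%E.

(* [esum] is meant for nonnegative families, so the absolutely convergent sum
   \sum_a c_a x^a is the sum of the positive parts minus that of the negative
   parts of its terms. The value is meaningful for 0 < x <= rho, with rho
   as in [gps_convergent]. *)
Definition gps_fun (R : realType) (F : gpseries R) (x : R) : R :=
  let term := fun a : R => (F a * x `^ a)%:E in
  fine (\esum_(a in coef_support F) term^\+%E a
        - \esum_(a in coef_support F) term^\-%E a)%E.

Definition has_gps_representation (R : realType) (f : R -> R) : Prop :=
  exists2 F : gpseries R, gps_convergent F &
    \forall x \near 0^'+, f x = gps_fun F x.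

Definition log_chart (R : realType) (f : R -> R) (z : R) : R :=
  - ln (f (expR (- z))).

(* The constant term of L is its coefficient at the exponent 0. *)
Definition has_dulac_representation (R : realType) (D : R -> R) : Prop :=
  exists (lambda c : R) (L : gpseries R),
    [/\ 0 < lambda, gps_convergent L, L 0 = 0 &
        \forall z \near +oo%R,
          D z = lambda * z + c + gps_fun L (expR (- z))].

Definition analytic_at (R : realType) (f : R -> R) (p : R) : Prop :=
  exists a : R^nat, \forall x \near p, pseries a (x - p) @ \oo --> f x.

Definition inverse_germs_at0 (R : realType) (f g : R -> R) : Prop :=
  (\forall x \near (0 : R), g (f x) = x) /\
  (\forall y \near (0 : R), f (g y) = y).

Definition analytic_diffeo_germ (R : realType) (f : R -> R) : Prop :=
  [/\ f 0 = 0, analytic_at f 0 &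
      exists g : R -> R,
        [/\ g 0 = 0, analytic_at g 0 & inverse_germs_at0 f g]].

Definition orientation_preserving_at0 (R : realType) (f : R -> R) : Prop :=
  0 < (f^`()%classic) 0.

(* Main.v *)
Require Import Defs.
From HB Require Import structures.
From mathcomp Require Import all_boot all_order all_algebra.
From mathcomp Require Import all_classical all_reals all_analysis.
From mathcomp Require Import ring lra.

Import Order.TTheory GRing.Theory Num.Theory.
Import numFieldNormedType.Exports.

Local Open Scope classical_set_scope.
Local Open Scope ring_scope.

(** A positive germ f tending to 0 has a convergent expansion exactly when it
    can be written f(x) = exp(lam * log x + c + W(x)) with lam > 0 and W a
    convergent series all of whose exponents are bounded below by some del > 0:
    factor out the leading term, f = k x^lam (1 + U) with U of positive order,
    and take W = log(1 + U), c = log k; conversely exp(W) expands and is only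
    multiplied by exp(c) x^lam. In the chart x = exp(-z) this exponential form
    of f is precisely a log-free Dulac representation of -log f(exp(-z)), with
    constant -c and series -W. Hence (1) <-> (3) and (2) <-> (4)
    ([gps_dulac]).

    For (1) <-> (2) the class of germs with a convergent expansion is closed
    under composition f o g with g positive and tending to 0 ([has_gps_comp]).
    Writing g = exp(lam * log x + c + W),

      f(g(x)) = sum_a F_a g(x)^a
              = sum_a F_a e^(c a) x^(lam a) exp(a W(x)),

    a sum of expandable functions of order lam a and of norm at most
    |F_a| (e^c rho^lam e^N)^a, where N bounds the norm of W; this is summable
    as soon as rho is so small that e^c rho^lam e^N is within the radius of
    convergence of F. An orientation-preserving analytic diffeomorphism germ
    and its inverse restrict to positive germs at 0+ that tend to 0 and expand
    in nonnegative integer powers ([diffeo_small_gps_germ]), so conjugation by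
    them, and conjugation back by their inverses, are instances of composition.

    All the closure properties of expansions follow from one statement,
    [rep_sum]: a normally convergent sum of expandable functions is expandable,
    provided that only finitely many summands have order at most B, for each B.
    Products, powers, substitution into a power series (hence the exponential
    and the logarithm) and the composition above are sums of this kind. The
    analytic content of [rep_sum] is the interchange of two absolutely
    convergent sums, [hasum_exchange]. *)

Set Implicit Arguments.
Unset Strict Implicit.

(** * Sums of absolutely summable real families *)

Lemma esum_fin (R : realType) (T : choiceType) (D : set T) (p : T -> R) :
  (forall i, D i -> 0 <= p i) -> (\esum_(i in D) (p i)%:E < +oo)%E ->
  exists2 P : R, 0 <= P & \esum_(i in D) (p i)%:E = P%:E.
Proof.
move=> p0 pfin.
have s0 : (0 <= \esum_(i in D) (p i)%:E)%E.
  by apply: esum_ge0 => i Di; rewrite lee_fin p0.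
exists (fine (\esum_(i in D) (p i)%:E)); first exact: fine_ge0.
by rewrite fineK// ge0_fin_numE.
Qed.

Lemma esum_lt (R : realType) (T : choiceType) (D : set T) (p q : T -> R) :
  (forall i, D i -> p i <= q i) -> (\esum_(i in D) (q i)%:E < +oo)%E ->
  (\esum_(i in D) (p i)%:E < +oo)%E.
Proof.
move=> pq; apply: le_lt_trans; apply: le_esum => i Di.
by rewrite lee_fin pq.
Qed.

Lemma esumZl (R : realType) (T : choiceType) (D : set T) (c : R)
    (p : T -> \bar R) : 0 <= c -> (forall i, D i -> (0 <= p i)%E) ->
  (\esum_(i in D) (c%:E * p i) = c%:E * \esum_(i in D) p i)%E.
Proof.
move=> c0 p0; rewrite esum_mkcond [in RHS]esum_mkcond.
pose q i := if i \in D then p i else 0%E.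
have q0 i : (0 <= q i)%E by rewrite /q; case: ifPn => // /set_mem /p0.
rewrite (_ : (fun i => _) = (fun i => c%:E * q i)%E); last first.
  by apply/funext => i; rewrite /q; case: ifP => //; rewrite mule0.
rewrite -/q /esum -ereal_supZl//; last first.
  apply/set0P; exists 0%E; exists set0; first exact: fsets_set0.
  by rewrite fsbig_set0.
congr ereal_sup; apply/seteqP; split => y /=.
- move=> [X [finX XD] <-]; exists (\sum_(i \in X) q i)%E; first by exists X.
  by rewrite ge0_mule_fsumr.
- move=> [_ [X [finX XD] <-] <-]; exists X => //.
  by rewrite ge0_mule_fsumr.
Qed.

Lemma esum_swap (R : realType) (I J : choiceType) (D : set I) (E : set J)
    (a : I -> J -> \bar R) : (forall i j, D i -> E j -> (0 <= a i j)%E) ->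
  (\esum_(i in D) \esum_(j in E) a i j = \esum_(j in E) \esum_(i in D) a i j)%E.
Proof.
move=> a0; rewrite !esum_esum//; last by move=> j i Ej Di; exact: a0.
apply: (@reindex_esum _ _ _ _ _ (fun k => (k.2, k.1)) (fun k => a k.1 k.2)).
split => [[j i] /= [? ?]|[j i] [j' i'] _ _ [-> ->]//|[i j] /= [Di Ej]] //.
by exists (j, i).
Qed.

(** The signed sum of a family as a relation: any splitting of f into two
    nonnegative families with finite sums may witness it. Leaving the splitting
    free makes addition, scaling and interchange of sums immediate, while
    [hasum_unique] shows that the value does not depend on it. *)
Definition hasum (R : realType) (T : choiceType) (D : set T) (f : T -> R)
    (s : R) := exists p q : T -> R, exists P Q : R,
  [/\ forall i, D i -> [/\ 0 <= p i, 0 <= q i & f i = p i - q i],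
      \esum_(i in D) (p i)%:E = P%:E, \esum_(i in D) (q i)%:E = Q%:E
    & s = P - Q].

Definition abs_summable (R : realType) (T : choiceType) (D : set T)
  (f : T -> R) := (\esum_(i in D) `|f i|%:E < +oo)%E.

(** The positive and negative parts of a real, in a form for which the
    identities below are linear in x and its absolute value. *)
Definition rpos (R : realType) (x : R) := (`|x| + x) / 2.
Definition rneg (R : realType) (x : R) := (`|x| - x) / 2.

Lemma rpos_ge0 (R : realType) (x : R) : 0 <= rpos x.
Proof. by rewrite divr_ge0// -[x in _ + x]opprK subr_ge0 -normrN ler_norm. Qed.

Lemma rneg_ge0 (R : realType) (x : R) : 0 <= rneg x.
Proof. by rewrite divr_ge0// subr_ge0 ler_norm. Qed.

Lemma rposBneg (R : realType) (x : R) : rpos x - rneg x = x.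
Proof. by rewrite /rpos /rneg; field. Qed.

Lemma rposDneg (R : realType) (x : R) : rpos x + rneg x = `|x|.
Proof. by rewrite /rpos /rneg; field. Qed.

Lemma rpos0 (R : realType) : rpos (0 : R) = 0.
Proof. by rewrite /rpos normr0 addr0 mul0r. Qed.

Lemma rneg0 (R : realType) : rneg (0 : R) = 0.
Proof. by rewrite /rneg normr0 subr0 mul0r. Qed.

Lemma rpos_le (R : realType) (x : R) : rpos x <= `|x|.
Proof. by rewrite -rposDneg lerDl rneg_ge0. Qed.

Lemma rneg_le (R : realType) (x : R) : rneg x <= `|x|.
Proof. by rewrite -rposDneg lerDr rpos_ge0. Qed.

(** If p - q = p' - q' then p + q' = p' + q, an identity between nonnegative
    families, whose sums can be compared. *)
Lemma hasum_unique (R : realType) (T : choiceType) (D : set T) (f : T -> R)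
    (s t : R) : hasum D f s -> hasum D f t -> s = t.
Proof.
move=> [p [q [P [Q [fpq eP eQ ->]]]]] [p' [q' [P' [Q' [fpq' eP' eQ' ->]]]]].
suff: P%:E + Q'%:E = (P'%:E + Q%:E)%E by move=> [] e; lra.
rewrite -eP -eQ -eP' -eQ' -!esumD//.
- apply: eq_esum => i Di; have [? ? e] := fpq _ Di.
  by have [? ? e'] := fpq' _ Di; congr EFin; lra.
all: by move=> i Di; rewrite lee_fin; have [] := fpq _ Di; have [] := fpq' _ Di.
Qed.

Lemma hasumB (R : realType) (T : choiceType) (D : set T) (p q : T -> R)
    (P Q : R) : (forall i, D i -> 0 <= p i) -> (forall i, D i -> 0 <= q i) ->
  \esum_(i in D) (p i)%:E = P%:E -> \esum_(i in D) (q i)%:E = Q%:E ->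
  hasum D (fun i => p i - q i) (P - Q).
Proof.
move=> p0 q0 eP eQ; exists p, q, P, Q; split => // i Di.
by rewrite p0// q0.
Qed.

Lemma eq_hasum (R : realType) (T : choiceType) (D : set T) (f g : T -> R)
    (s : R) : (forall i, D i -> f i = g i) -> hasum D f s -> hasum D g s.
Proof.
move=> fg [p [q [P [Q [fpq eP eQ ->]]]]]; exists p, q, P, Q; split => // i Di.
by rewrite -fg//; exact: fpq.
Qed.

Lemma hasum_posneg (R : realType) (T : choiceType) (D : set T) (f : T -> R)
    (P Q : R) : \esum_(i in D) (rpos (f i))%:E = P%:E ->
  \esum_(i in D) (rneg (f i))%:E = Q%:E -> hasum D f (P - Q).
Proof.
move=> eP eQ; apply: eq_hasum (hasumB _ _ eP eQ) => i _.
- exact: rposBneg.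
- exact: rpos_ge0.
- exact: rneg_ge0.
Qed.

Lemma hasum_abs_summable (R : realType) (T : choiceType) (D : set T)
    (f : T -> R) (s : R) : hasum D f s -> abs_summable D f.
Proof.
move=> [p [q [P [Q [fpq eP eQ _]]]]]; rewrite /abs_summable.
apply: (@le_lt_trans _ _ (P%:E + Q%:E)%E); last by rewrite ltry.
rewrite -eP -eQ -esumD; first last.
- by move=> i /fpq[]; rewrite lee_fin.
- by move=> i /fpq[]; rewrite lee_fin.
apply: le_esum => i /fpq[p0 q0 ->]; rewrite -EFinD lee_fin.
by rewrite (le_trans (ler_normB _ _))// !ger0_norm.
Qed.

Lemma abs_summable_posneg (R : realType) (T : choiceType) (D : set T)
    (f : T -> R) : abs_summable D f -> exists P Q : R,
  [/\ 0 <= P, 0 <= Q, \esum_(i in D) (rpos (f i))%:E = P%:E,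
      \esum_(i in D) (rneg (f i))%:E = Q%:E & hasum D f (P - Q)].
Proof.
move=> fs.
have [P P0 eP] : exists2 P : R, 0 <= P & \esum_(i in D) (rpos (f i))%:E = P%:E.
  apply: esum_fin; first by move=> *; exact: rpos_ge0.
  by apply: esum_lt fs => i _; exact: rpos_le.
have [Q Q0 eQ] : exists2 Q : R, 0 <= Q & \esum_(i in D) (rneg (f i))%:E = Q%:E.
  apply: esum_fin; first by move=> *; exact: rneg_ge0.
  by apply: esum_lt fs => i _; exact: rneg_le.
by exists P, Q; split => //; exact: hasum_posneg.
Qed.

(** The link with the value that [gps_fun] assigns to a series, which sums the
    extended-real positive and negative parts. *)
Lemma hasumE (R : realType) (T : choiceType) (D : set T) (f : T -> R) (s : R) :
  hasum D f s ->
  s = fine (\esum_(i in D) (EFin \o f)^\+%E i -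
            \esum_(i in D) (EFin \o f)^\-%E i)%E.
Proof.
move=> fs; have fsum := hasum_abs_summable fs.
have [P P0 eP] : exists2 P : R, 0 <= P &
    \esum_(i in D) (Num.max (f i) 0)%:E = P%:E.
  apply: esum_fin; first by move=> i _; rewrite le_max lexx orbT.
  by apply: esum_lt fsum => i _; rewrite ge_max ler_norm/=.
have [Q Q0 eQ] : exists2 Q : R, 0 <= Q &
    \esum_(i in D) (Num.max (- f i) 0)%:E = Q%:E.
  apply: esum_fin; first by move=> i _; rewrite le_max lexx orbT.
  by apply: esum_lt fsum => i _; rewrite ge_max -normrN ler_norm/=.
have -> : s = P - Q.
  apply: hasum_unique fs _; apply: eq_hasum (hasumB _ _ eP eQ) => i _.
  - case: (leP (f i) 0) => f0; first by rewrite max_l ?oppr_ge0// opprK add0r.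
    by rewrite max_r ?subr0// oppr_le0 ltW.
  - by rewrite le_max lexx orbT.
  - by rewrite le_max lexx orbT.
rewrite (_ : esum D _ = P%:E); last first.
  by rewrite -eP; apply: eq_esum => i _; rewrite funeposE/= EFin_max.
rewrite (_ : esum D _ = Q%:E)//.
by rewrite -eQ; apply: eq_esum => i _; rewrite funenegE/= EFin_max EFinN.
Qed.

Lemma hasum_norm (R : realType) (T : choiceType) (D : set T)
    (f : T -> R) (s : R) :
  hasum D f s -> (`|s|%:E <= \esum_(i in D) `|f i|%:E)%E.
Proof.
move=> fs; have [P [Q [P0 Q0 eP eQ fPQ]]] :=
  abs_summable_posneg (hasum_abs_summable fs).
rewrite (hasum_unique fs fPQ) (_ : esum D _ = (P%:E + Q%:E)%E); last first.
  rewrite -eP -eQ -esumD; first last.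
  - by move=> *; rewrite lee_fin rneg_ge0.
  - by move=> *; rewrite lee_fin rpos_ge0.
  by apply: eq_esum => i _; rewrite -EFinD rposDneg.
by rewrite -EFinD lee_fin (le_trans (ler_normB _ _))// !ger0_norm.
Qed.

Lemma hasumZ (R : realType) (T : choiceType) (D : set T)
    (c : R) (f : T -> R) (s : R) : hasum D f s ->
  hasum D (fun i => c * f i) (c * s).
Proof.
move=> [p [q [P [Q [fpq eP eQ ->]]]]].
have p0 i : D i -> (0 <= (p i)%:E)%E by move=> /fpq[]; rewrite lee_fin.
have q0 i : D i -> (0 <= (q i)%:E)%E by move=> /fpq[]; rewrite lee_fin.
have [c0|c0] := leP 0 c.
- exists (fun i => c * p i), (fun i => c * q i), (c * P), (c * Q).
  rewrite !EFinM -eP -eQ -!esumZl//; split => //; last by rewrite mulrBr.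
  by move=> i /fpq[? ? ->]; rewrite mulrBr !mulr_ge0.
- exists (fun i => - c * q i), (fun i => - c * p i), (- c * Q), (- c * P).
  have c1 : 0 <= - c by rewrite oppr_ge0 ltW.
  rewrite !EFinM -eP -eQ -!esumZl//; split => //; last by ring.
  by move=> i /fpq[? ? ->]; split; [exact: mulr_ge0..|ring].
Qed.

Lemma hasumD (R : realType) (T : choiceType) (D : set T)
    (f g : T -> R) (s t : R) : hasum D f s -> hasum D g t ->
  hasum D (fun i => f i + g i) (s + t).
Proof.
move=> [p [q [P [Q [fpq eP eQ ->]]]]] [p' [q' [P' [Q' [gpq eP' eQ' ->]]]]].
exists (fun i => p i + p' i), (fun i => q i + q' i), (P + P'), (Q + Q').
split; last by ring.
- move=> i Di; have [? ? ->] := fpq _ Di; have [? ? ->] := gpq _ Di.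
  by split; [exact: addr_ge0..|ring].
- rewrite EFinD -eP -eP' -esumD//.
  + by move=> i /fpq[]; rewrite lee_fin.
  + by move=> i /gpq[]; rewrite lee_fin.
- rewrite EFinD -eQ -eQ' -esumD//.
  + by move=> i /fpq[]; rewrite lee_fin.
  + by move=> i /gpq[]; rewrite lee_fin.
Qed.

Lemma hasum_reindex (R : realType) (T U : choiceType) (D : set T) (E : set U)
    (e : T -> U) (f : U -> R) (s : R) : set_bij D E e ->
  hasum E f s -> hasum D (f \o e) s.
Proof.
move=> bije [p [q [P [Q [fpq eP eQ ->]]]]].
exists (p \o e), (q \o e), P, Q; split => //.
- by move=> i Di; apply: fpq; case: bije => h _ _; exact: h.
- by rewrite -eP; apply/esym/(@reindex_esum _ _ _ _ _ e (fun i => (p i)%:E)).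
- by rewrite -eQ; apply/esym/(@reindex_esum _ _ _ _ _ e (fun i => (q i)%:E)).
Qed.

Lemma hasum_set1 (R : realType) (T : choiceType) (t : T) (f : T -> R) :
  (forall i, i != t -> f i = 0) -> hasum setT f (f t).
Proof.
move=> ft.
have one (g : R -> R) : (forall x, 0 <= g x) -> g 0 = 0 ->
    \esum_(i in setT) (g (f i))%:E = (g (f t))%:E.
  move=> g0 g00; rewrite -[RHS](@esum_set1 _ _ t (fun i => (g (f i))%:E)).
    rewrite [RHS]esum_mkcond; apply: eq_esum => i _.
    have [->|it] := eqVneq i t; first by rewrite mem_set.
    by rewrite memNset ?ft ?g00//= => /eqP; apply/negP.
  by rewrite lee_fin.
rewrite -(rposBneg (f t)); apply: hasum_posneg.
- by apply: one; [exact: rpos_ge0|exact: rpos0].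
- by apply: one; [exact: rneg_ge0|exact: rneg0].
Qed.

(** Fubini for families: the positive and the negative parts of f are summed
    separately, where the interchange is that of nonnegative double sums. The
    column sums g are produced rather than assumed, because in the application
    they are the coefficients of a new series. *)
Lemma hasum_exchange (R : realType) (I J : choiceType) (D : set I)
    (f : I -> J -> R) (s : I -> R) (S : R) :
  (\esum_(i in D) \esum_(j in setT) `|f i j|%:E < +oo)%E ->
  (forall i, D i -> hasum setT (f i) (s i)) -> hasum D s S ->
  exists2 g : J -> R, (forall j, hasum D (f^~ j) (g j)) & hasum setT g S.
Proof.
move=> fs fis sS.
(* applied below to the positive part and to the negative part *)
have key (h : R -> R) : (forall x, 0 <= h x <= `|x|) ->
    exists A : I -> R, exists B : J -> R, exists C : R,
    [/\ (forall i, D i ->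
           0 <= A i /\ \esum_(j in setT) (h (f i j))%:E = (A i)%:E),
        (forall j, 0 <= B j /\ \esum_(i in D) (h (f i j))%:E = (B j)%:E),
        \esum_(i in D) (A i)%:E = C%:E &
        \esum_(j in setT) (B j)%:E = C%:E].
  move=> hb.
  have h0 x : 0 <= h x by case/andP: (hb x).
  have hl x : h x <= `|x| by case/andP: (hb x).
  have fin2 : (\esum_(i in D) \esum_(j in setT) (h (f i j))%:E < +oo)%E.
    apply: le_lt_trans fs; apply: le_esum => i _; apply: le_esum => j _.
    by rewrite lee_fin.
  have inner (K L : choiceType) (E : set K) (E' : set L) (u : K -> L -> R) :
      (forall k l, 0 <= u k l) ->
      (\esum_(k in E) \esum_(l in E') (u k l)%:E < +oo)%E ->
      exists A : K -> R, forall k, E k ->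
        0 <= A k /\ \esum_(l in E') (u k l)%:E = (A k)%:E.
    move=> u0 ufin.
    suff /choice[A HA] : forall k, exists a : R, E k ->
        0 <= a /\ \esum_(l in E') (u k l)%:E = a%:E by exists A.
    move=> k; have [Ek|nEk] := pselect (E k); last by exists 0.
    have [|a a0 ea] := @esum_fin R _ E' (u k) (fun _ _ => u0 _ _).
      apply: le_lt_trans ufin; rewrite (esumID [set k])//; last first.
        by move=> k' _; apply: esum_ge0 => *; rewrite lee_fin.
      rewrite (_ : E `&` [set k] = [set k]); last by apply/setIidPr => x /= ->.
      rewrite esum_set1; last by apply: esum_ge0 => *; rewrite lee_fin.
      rewrite leeDl//; apply: esum_ge0 => *.
      by apply: esum_ge0 => *; rewrite lee_fin.
    by exists a.
  have [A HA] := inner _ _ D setT _ (fun i j => h0 (f i j)) fin2.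
  have fin2' := fin2; rewrite esum_swap in fin2'; last first.
    by move=> *; rewrite lee_fin.
  have [B HB] := inner _ _ setT D _ (fun j i => h0 (f i j)) fin2'.
  have [C _ eC] : exists2 C : R, 0 <= C & \esum_(i in D) (A i)%:E = C%:E.
    apply: esum_fin; first by move=> i /HA[].
    apply: le_lt_trans fin2; apply: le_esum => i Di.
    by have [_ ->] := HA _ Di.
  exists A, B, C; split => //; first by move=> j; exact: HB.
  rewrite -eC (_ : esum D _ = \esum_(i in D) \esum_(j in setT) (h (f i j))%:E).
    rewrite esum_swap; last by move=> *; rewrite lee_fin.
    by apply: eq_esum => j _; have [_ ->] := HB j Logic.I.
  by apply: eq_esum => i Di; have [_ ->] := HA _ Di.
have [A [B [C [HA HB eA eB]]]] : _ := key (@rpos R)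
  (fun x => introT andP (conj (rpos_ge0 x) (rpos_le x))).
have [A' [B' [C' [HA' HB' eA' eB']]]] : _ := key (@rneg R)
  (fun x => introT andP (conj (rneg_ge0 x) (rneg_le x))).
have sE i : D i -> s i = A i - A' i.
  move=> Di; apply: hasum_unique (fis _ Di) _.
  have [_ e] := HA _ Di; have [_ e'] := HA' _ Di.
  exact: hasum_posneg.
have -> : S = C - C'.
  apply: hasum_unique sS _.
  apply: eq_hasum (hasumB _ _ eA eA') => [i /sE //|i /HA[]//|i /HA'[]//].
exists (fun j => B j - B' j).
  move=> j; have [_ e] := HB j; have [_ e'] := HB' j.
  exact: hasum_posneg.
by apply: hasumB => // j _; [case: (HB j)|case: (HB' j)].
Qed.

Lemma hasum_supported (R : realType) (T : choiceType) (D : set T) (f : T -> R)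
    (s : R) : (forall i, ~ D i -> f i = 0) ->
  hasum setT f s <-> hasum D f s.
Proof.
move=> fD.
have mk (h : R -> R) : h 0 = 0 ->
    \esum_(i in D) (h (f i))%:E = \esum_(i in setT) (h (f i))%:E.
  move=> h0; rewrite esum_mkcond; apply: eq_esum => i _.
  by case: ifPn => // /negP; rewrite inE => /fD ->; rewrite h0.
split=> fs; have [P [Q [_ _ eP eQ fPQ]]] :=
    abs_summable_posneg (hasum_abs_summable fs);
  rewrite (hasum_unique fs fPQ); apply: hasum_posneg;
  by rewrite -?eP -?eQ mk ?rpos0 ?rneg0.
Qed.

Lemma esum_series (R : realType) (f : R^nat) (s : R) :
  (forall n, 0 <= f n) -> series f @ \oo --> s ->
  \esum_(n in setT) (f n)%:E = s%:E.
Proof.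
move=> f0 fs; rewrite -nneseries_esumT; last by move=> n; rewrite lee_fin.
apply/cvg_lim => //; apply/fine_cvgP; split.
  by apply: nearW => n; rewrite sumEFin.
apply: cvg_trans fs; apply: near_eq_cvg; apply: nearW => n.
by rewrite /= sumEFin.
Qed.

(** Absolute convergence turns the limit of the partial sums into an
    unordered sum. *)
Lemma series_hasum (R : realType) (f : R^nat) (s : R) :
  cvgn (series (fun n => `|f n|)) -> series f @ \oo --> s -> hasum setT f s.
Proof.
move=> fc fs.
have cp : cvgn (series (fun n => rpos (f n))).
  apply: series_le_cvg fc => n //; [exact: rpos_ge0|exact: rpos_le].
have cn : cvgn (series (fun n => rneg (f n))).
  apply: series_le_cvg fc => n //; [exact: rneg_ge0|exact: rneg_le].
rewrite (_ : s = limn (series (fun n => rpos (f n))) -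
                 limn (series (fun n => rneg (f n)))).
  apply: hasum_posneg.
  - by apply: esum_series => // n; exact: rpos_ge0.
  - by apply: esum_series => // n; exact: rneg_ge0.
apply: (cvg_unique _ fs) => //.
rewrite (_ : series f =
    series (fun n => rpos (f n)) - series (fun n => rneg (f n))).
  exact: cvgB.
apply/funext => n; rewrite !fctE /series/= -sumrB.
by apply: eq_bigr => i _; rewrite rposBneg.
Qed.
(** * Functions with a normally convergent expansion *)

(** F expands f on (0, rho], with exponents at least del and with norm
    sum_a |F_a| rho^a at most M. The order del may be negative, so that dividing
    by a leading monomial stays within the notion. The bounds M and del are
    carried along because they are what the summability and local finiteness
    conditions of [rep_sum] are about. *)
Definition represents (R : realType) (F : R -> R) (rho M del : R)
    (f : R -> R) :=
  [/\ natural_set (coef_support F), forall a, F a != 0 -> del <= a,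
      (\esum_(a in setT) (`|F a| * rho `^ a)%:E <= M%:E)%E &
      forall x, 0 < x <= rho -> hasum setT (fun a => F a * x `^ a) (f x)].

Definition rep (R : realType) (rho M del : R) (f : R -> R) :=
  exists F, represents F rho M del f.

Lemma powR_ratio (R : realType) (x rho a : R) : 0 < x -> 0 < rho ->
  x `^ a = (x / rho) `^ a * rho `^ a.
Proof.
move=> x0 r0; rewrite -powRM ?divr_ge0 ?ltW//.
by rewrite divfK// gt_eqF.
Qed.

(** Since x / rho <= 1 and every exponent a is at least del, each
    x^a = (x / rho)^a rho^a is at most (x / rho)^del rho^a. *)
Lemma esum_shrink (R : realType) (F : R -> R) (rho x del : R) :
  (forall a, F a != 0 -> del <= a) -> 0 < rho -> 0 < x <= rho ->
  (\esum_(a in setT) (`|F a| * x `^ a)%:E <=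
   ((x / rho) `^ del)%:E * \esum_(a in setT) (`|F a| * rho `^ a)%:E)%E.
Proof.
move=> Fd r0 /andP[x0 xr]; rewrite -esumZl ?powR_ge0//; last first.
  by move=> a _; rewrite lee_fin mulr_ge0 ?powR_ge0.
apply: le_esum => a _; rewrite -EFinM lee_fin.
have [->|Fa] := eqVneq (F a) 0; first by rewrite normr0 !mul0r mulr0.
rewrite (@powR_ratio _ x rho a)// mulrCA ler_wpM2r ?mulr_ge0 ?powR_ge0//.
by rewrite ger_powR ?Fd// divr_gt0//= ler_pdivrMr// mul1r.
Qed.

Lemma represents_norm_ge0 (R : realType) (F : R -> R) (rho M del : R)
    (f : R -> R) : represents F rho M del f -> 0 <= M.
Proof.
case=> _ _ FM _; rewrite -lee_fin; apply: le_trans FM.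
by apply: esum_ge0 => a _; rewrite lee_fin mulr_ge0 ?powR_ge0.
Qed.

Lemma rep_norm_ge0 (R : realType) (rho M del : R) (f : R -> R) :
  rep rho M del f -> 0 <= M.
Proof. by case=> F; exact: represents_norm_ge0. Qed.

Lemma rep_bound (R : realType) (rho M del : R) (f : R -> R) (x : R) :
  rep rho M del f -> 0 < x <= rho -> `|f x| <= (x / rho) `^ del * M.
Proof.
move=> [F [_ Fd FM Fh]] xr.
have r0 : 0 < rho by case/andP: xr; exact: lt_le_trans.
rewrite -lee_fin; apply: le_trans (hasum_norm (Fh _ xr)) _.
under eq_esum => a _ do rewrite normrM (ger0_norm (powR_ge0 _ _)).
apply: le_trans (esum_shrink Fd r0 xr) _.
by rewrite EFinM lee_pmul2l// ?lte_fin ?powR_gt0// divr_gt0//; case/andP: xr.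
Qed.

Lemma rep_bound1 (R : realType) (rho M del : R) (f : R -> R) (x : R) :
  0 <= del -> rep rho M del f -> 0 < x <= rho -> `|f x| <= M.
Proof.
move=> d0 frep xr; apply: le_trans (rep_bound frep xr) _.
rewrite ler_piMl//; first exact: rep_norm_ge0 frep.
case/andP: xr => x0 xr; have r0 := lt_le_trans x0 xr.
have h : 0 < x / rho <= 1 by rewrite divr_gt0//= ler_pdivrMr// mul1r.
by rewrite -(powRr0 (x / rho)); exact: ger_powR.
Qed.

Lemma rep_weaken (R : realType) (rho M M' del del' : R) (f g : R -> R) :
  M <= M' -> del' <= del -> (forall x, 0 < x <= rho -> f x = g x) ->
  rep rho M del f -> rep rho M' del' g.
Proof.
move=> MM dd fg [F [Fn Fd FM Fh]]; exists F; split => //.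
- by move=> a /Fd; exact: le_trans.
- by apply: le_trans FM _; rewrite lee_fin.
- by move=> x xr; rewrite -fg//; exact: Fh.
Qed.

Lemma rep_shrink (R : realType) (rho r M del : R) (f : R -> R) :
  0 < r <= rho -> rep rho M del f -> rep r ((r / rho) `^ del * M) del f.
Proof.
move=> rr [F [Fn Fd FM Fh]]; exists F; split => //.
- have r0 : 0 < rho by case/andP: rr; exact: lt_le_trans.
  apply: le_trans (esum_shrink Fd r0 rr) _.
  by rewrite EFinM lee_pmul2l// ?lte_fin ?powR_gt0// divr_gt0//; case/andP: rr.
- move=> x /andP[x0 xr]; apply: Fh; rewrite x0/=.
  by apply: le_trans xr _; case/andP: rr.
Qed.

Lemma rep_shrink0 (R : realType) (rho r M del : R) (f : R -> R) :
  0 <= del -> 0 < r <= rho -> rep rho M del f -> rep r M del f.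
Proof.
move=> d0 rr frep; apply: rep_weaken (rep_shrink rr frep) => //.
rewrite ler_piMl//; first exact: rep_norm_ge0 frep.
case/andP: rr => r0 rr; have rho0 := lt_le_trans r0 rr.
have h : 0 < r / rho <= 1 by rewrite divr_gt0//= ler_pdivrMr// mul1r.
by rewrite -(powRr0 (r / rho)); exact: ger_powR.
Qed.

(** Normally convergent sums of expansions are expansions. The coefficient of
    x^a in the sum is the sum over i of the coefficients F_i(a); interchanging
    the sums over i and over a shows that these coefficients expand g. Their
    support is natural because below B it only meets the supports of the
    finitely many summands of order at most B. *)
Lemma rep_sum (R : realType) (I : choiceType) (D : set I) (f : I -> R -> R)
    (M del : I -> R) (rho K d0 : R) (g : R -> R) : 0 < rho ->
  (forall i, D i -> rep rho (M i) (del i) (f i)) ->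
  (\esum_(i in D) (M i)%:E <= K%:E)%E ->
  (forall B, finite_set (D `&` [set i | del i <= B])) ->
  (forall i, D i -> d0 <= del i) ->
  (forall x, 0 < x <= rho -> hasum D (f^~ x) (g x)) ->
  rep rho K d0 g.
Proof.
move=> r0 frep MK dfin dd fg.
have /choice[F HF] : forall i, exists F, D i ->
    represents F rho (M i) (del i) (f i).
  move=> i; have [/frep[F ?]|?] := pselect (D i); first by exists F.
  by exists (fun=> 0).
have dFi i a : D i -> F i a != 0 -> d0 <= a.
  by move=> Di; have [_ h _ _] := HF _ Di => /h; apply: le_trans; exact: dd.
have sumx x : 0 < x <= rho ->
    (\esum_(i in D) \esum_(a in setT) `|F i a * x `^ a|%:E <=
     ((x / rho) `^ d0)%:E * K%:E)%E.
  move=> /[dup] /andP[x0 xr] xr'.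
  apply: (@le_trans _ _ (((x / rho) `^ d0)%:E * \esum_(i in D) (M i)%:E)%E).
    rewrite -esumZl ?powR_ge0//; last first.
      by move=> i /frep /rep_norm_ge0; rewrite lee_fin.
    apply: le_esum => i Di.
    under eq_esum => a _ do rewrite normrM (ger0_norm (powR_ge0 _ _)).
    apply: le_trans (@esum_shrink _ _ _ _ d0 _ r0 xr') _.
      by move=> a; exact: dFi.
    rewrite lee_pmul2l// ?lte_fin ?powR_gt0 ?divr_gt0//.
    by have [] := HF _ Di.
  by rewrite lee_pmul2l// lte_fin ?powR_gt0 ?divr_gt0.
have fin x : 0 < x <= rho ->
    (\esum_(i in D) \esum_(a in setT) `|F i a * x `^ a|%:E < +oo)%E.
  by move=> /sumx /le_lt_trans; apply; rewrite -EFinM ltry.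
have rr : 0 < rho <= rho by rewrite r0 lexx.
have Fih x i : 0 < x <= rho -> D i ->
    hasum setT (fun a => F i a * x `^ a) (f i x).
  by move=> xr Di; have [_ _ _] := HF _ Di; apply.
(* The coefficients are obtained from the interchange at the single point rho;
   that they work at every x follows from uniqueness of sums. *)
have [Gr HGr _] := hasum_exchange (fin _ rr) (fun i => Fih _ i rr) (fg _ rr).
have HG a : hasum D (F^~ a) (Gr a / rho `^ a).
  rewrite mulrC; apply: eq_hasum (hasumZ (rho `^ a)^-1 (HGr a)) => i _ /=.
  by rewrite mulrC mulfK// gt_eqF// powR_gt0.
have Gsupp a : Gr a / rho `^ a != 0 -> exists2 i, D i & F i a != 0.
  move=> Ga; apply: contrapT => nex; move/eqP: Ga; apply.
  apply: hasum_unique (HG a) _.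
  have := hasumZ 0 (HG a); rewrite mul0r; apply: eq_hasum => i Di.
  rewrite mul0r; apply/esym/eqP; apply/negPn/negP => Fia.
  by apply: nex; exists i.
exists (fun a => Gr a / rho `^ a); split.
- move=> B; apply: (@sub_finite_set _ _ 
    (\bigcup_(i in D `&` [set i | del i <= B])
      (coef_support (F i) `&` [set x | x <= B]))).
    move=> a [/= /Gsupp[i Di Fia] aB]; exists i => //; split => //=.
    by apply: le_trans aB; have [_ h _ _] := HF _ Di; exact: h.
  apply: bigcup_finite => // i [Di _].
  by have [h _ _ _] := HF _ Di; exact: h.
- by move=> a /Gsupp[i Di]; exact: dFi.
- apply: (@le_trans _ _
    (\esum_(a in setT) \esum_(i in D) `|F i a * rho `^ a|%:E)%E).
    apply: le_esum => a _.
    rewrite -[X in _ * X]ger0_norm ?powR_ge0// -normrM divfK; last first.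
      by rewrite gt_eqF// powR_gt0.
    exact: hasum_norm (HGr a).
  rewrite esum_swap; last by move=> *; rewrite lee_fin.
  apply: le_trans (sumx _ rr) _.
  by rewrite divff ?gt_eqF// powR1 mul1e.
- move=> x xr.
  have [g' Hg' Hs] := hasum_exchange (fin _ xr) (fun i => Fih _ i xr) (fg _ xr).
  apply: eq_hasum Hs => a _; apply: hasum_unique (Hg' a) _.
  rewrite mulrC; apply: eq_hasum (hasumZ (x `^ a) (HG a)) => i _ /=.
  by rewrite mulrC.
Qed.

Lemma rep_shift (R : realType) (rho M del c b : R) (f : R -> R) : 0 < rho ->
  rep rho M del f ->
  rep rho (`|c| * rho `^ b * M) (b + del) (fun x => c * x `^ b * f x).
Proof.
move=> r0 [F [Fn Fd FM Fh]].
have bij : set_bij [set: R] [set: R] (fun a => a - b).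
  split => //; first by move=> x y _ _ /= /addIr.
  by move=> y _; exists (y + b) => //=; rewrite addrK.
exists (fun a => c * F (a - b)); split.
- move=> B; apply: (@sub_finite_set _ _ ((fun a => a + b) @`
    (coef_support F `&` [set x | x <= B - b]))); last first.
    by apply: finite_image; exact: Fn.
  move=> a [/= cF aB]; exists (a - b); last by rewrite subrK.
  split; last by rewrite /= lerD2r.
  by apply: contraNneq cF => ->; rewrite mulr0.
- move=> a cF; rewrite addrC -lerBrDr; apply: Fd.
  by apply: contraNneq cF => ->; rewrite mulr0.
- apply: (@le_trans _ _
    ((`|c| * rho `^ b)%:E * \esum_(a in setT) (`|F a| * rho `^ a)%:E)%E).
    rewrite -esumZl ?mulr_ge0 ?powR_ge0//; last first.
      by move=> a _; rewrite lee_fin mulr_ge0 ?powR_ge0.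
    rewrite [leRHS](@reindex_esum _ _ _ _ _ _ _ bij); apply: le_esum => a _.
    rewrite -EFinM lee_fin normrM -!mulrA ler_wpM2l// mulrCA ler_wpM2l//.
    by rewrite -powRD ?(gt_eqF r0) ?implybT// addrC subrK.
  rewrite [in leRHS]EFinM; apply: lee_wpmul2l => //.
  by rewrite lee_fin mulr_ge0 ?powR_ge0.
- move=> x /[dup] /Fh h /andP[x0 _].
  apply: eq_hasum (hasumZ (c * x `^ b) (hasum_reindex bij h)) => a _ /=.
  rewrite -!mulrA; congr (_ * _); rewrite mulrCA; congr (_ * _).
  by rewrite -powRD ?(gt_eqF x0) ?implybT// addrC subrK.
Qed.

Lemma rep_scale (R : realType) (rho M del c : R) (f : R -> R) : 0 < rho ->
  rep rho M del f -> rep rho (`|c| * M) del (fun x => c * f x).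
Proof.
move=> r0 frep; apply: rep_weaken (rep_shift c 0 r0 frep).
- by rewrite powRr0 mulr1.
- by rewrite add0r.
- by move=> x _; rewrite powRr0 mulr1.
Qed.

Lemma rep_one (R : realType) (rho : R) : rep rho 1 0 (fun=> 1).
Proof.
have one (x : R) : hasum setT (fun a => (a == 0)%:R * x `^ a) (1 : R).
  have := @hasum_set1 R R 0 (fun a => (a == 0)%:R * x `^ a).
  rewrite eqxx mul1r powRr0; apply => i /negPf ->.
  by rewrite mul0r.
exists (fun a => (a == 0)%:R); split => //.
- move=> B; apply: (@sub_finite_set _ _ [set 0]) => // a [/= + _].
  by rewrite /coef_support/=; case: (eqVneq a 0) => // _; rewrite mulr0n eqxx.
- by move=> a; case: (eqVneq a 0) => [->|]; rewrite ?mulr0n ?eqxx.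
- rewrite (_ : esum _ _ =
      \esum_(a in [set 0 : R]) (`|(a == 0)%:R| * rho `^ a)%:E).
    rewrite esum_set1 ?lee_fin ?mulr_ge0 ?powR_ge0//.
    by rewrite eqxx normr1 mul1r powRr0.
  rewrite [RHS]esum_mkcond; apply: eq_esum => a _; case: ifPn => //.
  by rewrite notin_setE/= => /eqP/negPf ->; rewrite normr0 mul0r.
Qed.

Lemma rep_monomial (R : realType) (rho c b : R) : 0 < rho ->
  rep rho (`|c| * rho `^ b) b (fun x => c * x `^ b).
Proof.
move=> r0; apply: rep_weaken (rep_shift c b r0 (rep_one rho)).
- by rewrite mulr1.
- by rewrite addr0.
- by move=> x _; rewrite mulr1.
Qed.

(** f g = sum_a F_a x^a g, a sum of shifted copies of g. *)
Lemma rep_mul (R : realType) (rho M N del eta : R) (f g : R -> R) : 0 < rho ->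
  rep rho M del f -> rep rho N eta g ->
  rep rho (M * N) (del + eta) (fun x => f x * g x).
Proof.
move=> r0 [F [Fn Fd FM Fh]] grep; have N0 := rep_norm_ge0 grep.
apply: (@rep_sum _ _ (coef_support F) (fun a x => F a * x `^ a * g x)
  (fun a => `|F a| * rho `^ a * N) (fun a => a + eta)) => //.
- by move=> a _; exact: rep_shift.
- rewrite EFinM muleC.
  under eq_esum => a _ do rewrite EFinM muleC.
  rewrite esumZl//; last by move=> a _; rewrite lee_fin mulr_ge0 ?powR_ge0.
  apply: lee_wpmul2l; first by rewrite lee_fin.
  apply: le_trans FM; rewrite esum_mkcond; apply: le_esum => a _.
  by case: ifP => // _; rewrite lee_fin mulr_ge0 ?powR_ge0.
- move=> B; rewrite (_ : [set a | _] = [set a | a <= B - eta]).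
    exact: Fn.
  by apply/seteqP; split => a /=; rewrite lerBrDr.
- by move=> a /= Fa; rewrite lerD2r Fd.
- move=> x /Fh Fx; apply/hasum_supported.
    by move=> a /=; move/negP/negPn/eqP => ->; rewrite !mul0r.
  rewrite mulrC; apply: eq_hasum (hasumZ (g x) Fx) => a _.
  by rewrite mulrC.
Qed.

Lemma rep_exprn (R : realType) (rho M del : R) (f : R -> R) (n : nat) :
  0 < rho -> rep rho M del f ->
  rep rho (M ^+ n) (n%:R * del) (fun x => f x ^+ n).
Proof.
move=> r0 frep; elim: n => [|n IH].
  by rewrite mul0r; exact: rep_one.
apply: rep_weaken (rep_mul r0 frep IH) => //.
- by rewrite exprS.
- by rewrite -natr1 mulrDl mul1r addrC.
- by move=> x _; rewrite exprS.
Qed.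

(** Substitution of u into a power series. As u has positive order del, the
    n-th term has order n del, so only finitely many terms have order below a
    given bound; K bounds the norm because the norm is submultiplicative. If the
    series starts at degree m, the result has order m del. *)
Lemma rep_pseries (R : realType) (rho M del K : R) (u g : R -> R) (m : nat)
    (a : R^nat) : 0 < rho -> 0 < del -> rep rho M del u ->
  (forall n, (n < m)%N -> a n = 0) ->
  pseries (fun n => `|a n|) M @ \oo --> K ->
  (forall x, 0 < x <= rho -> pseries a (u x) @ \oo --> g x) ->
  rep rho K (m%:R * del) g.
Proof.
move=> r0 d0 urep a0 aM ag; have M0 := rep_norm_ge0 urep.
have anM : \esum_(n in setT) (`|a n| * M ^+ n)%:E = K%:E.
  by apply: esum_series => // n; rewrite mulr_ge0// exprn_ge0.
apply: (@rep_sum _ _ [set n | (m <= n)%N] (fun n x => a n * u x ^+ n)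
   (fun n => `|a n| * M ^+ n) (fun n => n%:R * del)) => //.
- by move=> n _; exact: rep_scale (rep_exprn n r0 urep).
- rewrite -anM esum_mkcond; apply: le_esum => n _.
  by case: ifP => // _; rewrite lee_fin mulr_ge0// exprn_ge0.
- move=> B; apply: (@sub_finite_set _ _ `I_(Num.bound `|B / del|)) => //.
  move=> n [_ /=]; rewrite -ler_pdivlMr// => nB.
  rewrite -(ltr_nat R); apply: le_lt_trans nB _.
  by apply: le_lt_trans (ler_norm _) _; apply: archi_boundP.
- by move=> n /= mn; rewrite ler_wpM2r ?ler_nat// ltW.
- move=> x xr; apply/hasum_supported.
    by move=> n /= /negP; rewrite -ltnNge => /a0 ->; rewrite mul0r.
  apply: series_hasum; last exact: ag.
  have ac : cvgn (series (fun n => `|a n| * M ^+ n)) by apply: cvgP aM.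
  apply: series_le_cvg ac => n //; first by rewrite mulr_ge0// exprn_ge0.
  rewrite normrM ler_wpM2l// normrX lerXn2r ?nnegrE//.
  exact: rep_bound1 (ltW d0) urep xr.
Qed.
(** * Germs at zero and their generalized power series *)

Lemma near0_rightP (R : realType) (P : R -> Prop) :
  (\forall x \near 0^'+, P x) <->
  exists2 e : R, 0 < e & forall x, 0 < x <= e -> P x.
Proof.
split.
- move=> /nbhs_ballP[e /= e0 He]; exists (e / 2); first by rewrite divr_gt0.
  move=> x /andP[x0 xe]; apply: He => //=.
  rewrite /ball/= sub0r normrN gtr0_norm// (le_lt_trans xe)//.
  by rewrite ltr_pdivrMr// ltr_pMr// ltr1n.
- move=> [e e0 He]; near=> x; apply: He; apply/andP; split; near: x.
  + exact: nbhs_right_gt.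
  + exact: nbhs_right_le.
Unshelve. all: by end_near. Qed.

Lemma near0P (R : realType) (P : R -> Prop) :
  (\forall x \near (0 : R), P x) <->
  exists2 e : R, 0 < e & forall x, `|x| < e -> P x.
Proof.
split.
- move=> /nbhs_ballP[e /= e0 He]; exists e => // x xe; apply: He => //=.
  by rewrite /ball/= sub0r normrN.
- move=> [e e0 He]; apply/nbhs_ballP; exists e => // x.
  by rewrite /ball/= sub0r normrN; exact: He.
Qed.

Lemma esum_coef_support (R : realType) (F : R -> R) (rho : R) :
  \esum_(a in coef_support F) (`|F a| * rho `^ a)%:E =
  \esum_(a in setT) (`|F a| * rho `^ a)%:E.
Proof.
rewrite esum_mkcond; apply: eq_esum => a _; case: ifPn => //.
by rewrite notin_setE/= => /negP/negPn/eqP ->; rewrite normr0 mul0r.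
Qed.

Lemma hasum_gps_fun (R : realType) (F : gpseries R) (x s : R) :
  hasum setT (fun a => F a * x `^ a) s -> gps_fun F x = s.
Proof.
move=> Fs; apply/esym; rewrite /gps_fun; apply: hasumE.
apply/hasum_supported => // a /negP/negPn/eqP ->; by rewrite mul0r.
Qed.

Lemma gps_fun_represents (R : realType) (F : gpseries R) : gps_convergent F ->
  exists rho M : R, 0 < rho /\ represents F rho M 0 (gps_fun F).
Proof.
move=> [rho r0]; rewrite esum_coef_support => Fr.
have Fge a : F a != 0 -> 0 <= a by exact: (@gps_support_ge0 _ F).
have fin x : 0 < x <= rho -> (\esum_(a in setT) (`|F a| * x `^ a)%:E < +oo)%E.
  move=> xr; apply: le_lt_trans (esum_shrink Fge r0 xr) _.
  by rewrite powRr0 mul1e.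
have [|M _ eM] := esum_fin _ Fr.
  by move=> a _; rewrite mulr_ge0 ?powR_ge0.
exists rho, M; split => //; split => //.
- exact: gps_support_natural.
- by rewrite eM.
- move=> x xr.
  have [|P [Q [_ _ _ _ Fs]]] :=
      @abs_summable_posneg R R setT (fun a => F a * x `^ a).
    rewrite /abs_summable.
    under eq_esum => a _ do rewrite normrM (ger0_norm (powR_ge0 _ _)).
    exact: fin.
  by rewrite (hasum_gps_fun Fs).
Qed.

Lemma gps_rep (R : realType) (f : R -> R) : has_gps_representation f ->
  exists rho M : R, 0 < rho /\ rep rho M 0 f.
Proof.
move=> [F /gps_fun_represents[r [M [r0 Frep]]] /near0_rightP[e e0 fF]].
have rr : 0 < Num.min r e <= r by rewrite lt_min r0 e0/= ge_min lexx.
exists (Num.min r e), M; split; first by case/andP: rr.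
have : rep r M 0 (gps_fun F) by exists F.
move=> /(rep_shrink0 (lexx _) rr); apply: rep_weaken => //.
by move=> x /andP[x0]; rewrite le_min => /andP[_ xe]; rewrite fF// x0.
Qed.

Lemma rep_gps_fun (R : realType) (f : R -> R) (rho M del : R) : 0 < rho ->
  0 <= del -> rep rho M del f ->
  exists F : gpseries R, [/\ gps_convergent F, forall a, F a != 0 -> del <= a &
    forall x, 0 < x <= rho -> f x = gps_fun F x].
Proof.
move=> r0 d0 [F [Fn Fd FM Fh]].
have Fge : coef_support F `<=` [set a | 0 <= a].
  by move=> a /Fd; exact: le_trans.
exists (GPSeries Fge Fn); split => //.
- exists rho => //; rewrite esum_coef_support.
  by apply: le_lt_trans FM _; rewrite ltry.
- by move=> x /Fh h; rewrite (@hasum_gps_fun _ (GPSeries Fge Fn) _ _ h).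
Qed.

Lemma rep_gps (R : realType) (f : R -> R) (rho M del : R) : 0 < rho ->
  0 <= del -> rep rho M del f -> has_gps_representation f.
Proof.
move=> r0 d0 /(rep_gps_fun r0 d0)[F [Fc _ FE]]; exists F => //.
by apply/near0_rightP; exists rho.
Qed.

Lemma has_gps_near (R : realType) (f g : R -> R) :
  (\forall x \near 0^'+, f x = g x) -> has_gps_representation f ->
  has_gps_representation g.
Proof.
move=> fg [F Fc fF]; exists F => //; near=> x.
have <- : f x = g x by near: x.
by near: x.
Unshelve. all: by end_near. Qed.

(** * Exponential and logarithm of an expansion *)

Lemma rep_expR (R : realType) (u : R -> R) (rho M del : R) : 0 < rho ->
  0 < del -> rep rho M del u -> rep rho (expR M) 0 (fun x => expR (u x)).
Proof.
move=> r0 d0 urep.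
have expc (x : R) : pseries (fun n => n`!%:R^-1) x @ \oo --> expR x.
  rewrite expRE /pseries -exp_coeffE.
  exact: (is_cvg_series_exp_coeff x).
have := @rep_pseries R rho M del (expR M) u (fun x => expR (u x)) 0
  (fun n => n`!%:R^-1) r0 d0 urep.
rewrite mul0r; apply => //.
rewrite (_ : (fun n => _) = (fun n => n`!%:R^-1)); first exact: expc.
by apply/funext => n; rewrite ger0_norm.
Qed.

Lemma is_cvg_seriesS (R : realType) (u : R^nat) : cvgn (series u) ->
  cvgn (series (fun n => u n.+1)).
Proof.
move=> /cvg_ex[l cu]; rewrite (_ : series _ = (fun n => series u n.+1 - u 0%N)).
  apply: (cvgP (l - u 0%N)); apply: cvgB; last exact: cvg_cst.
  by rewrite cvg_shiftS.
apply/funext => n; rewrite /series/= [in RHS]big_nat_recl// addrAC subrr add0r.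
by [].
Qed.

(** The factor n + 1 is absorbed by shrinking the radius by 4: one factor 2
    makes the convergence absolute, the other dominates n + 1. *)
Lemma is_cvg_pseries_diffs (R : realType) (c : R^nat) (K : R) : 0 < K ->
  cvgn (pseries c K) -> cvgn (pseries (pseries_diffs c) (K / 4)).
Proof.
move=> K0 cK.
have c2 : cvgn (pseries (fun n => `|c n|) (K / 2)).
  apply: is_cvg_pseries_inside_norm cK _.
  rewrite !gtr0_norm ?divr_gt0//; lra.
apply: normed_cvg; rewrite /normed_series_of.
have c3 : cvgn (series (fun n => (4 / K) * (`|c n.+1| * (K / 2) ^+ n.+1))).
  by apply: is_cvg_seriesZ; exact: is_cvg_seriesS c2.
apply: series_le_cvg c3 => n; first exact: normr_ge0.
  apply: mulr_ge0; first by rewrite divr_ge0// ltW.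
  by rewrite mulr_ge0// exprn_ge0// divr_ge0// ltW.
have -> : 4 / K * (`|c n.+1| * (K / 2) ^+ n.+1) =
    `|c n.+1| * (2 * (K / 2) ^+ n).
  by rewrite exprS; field; rewrite gt_eqF.
have K4 : 0 < K / 4 by rewrite divr_gt0.
rewrite /= /pseries_diffs !normrM normr_nat normrX (gtr0_norm K4).
rewrite mulrAC mulrC ler_wpM2l//.
rewrite (_ : K / 4 = (1 / 2) * (K / 2)); last by field.
rewrite exprMn mulrA ler_wpM2r ?exprn_ge0 ?divr_ge0 ?(ltW K0)//.
rewrite expr_div_n expr1n mul1r ler_pdivrMr ?exprn_gt0// -exprS -natrX ler_nat.
by rewrite ltnW// ltn_expl.
Qed.

(** The Taylor coefficients of log(1 + x) at 0. *)
Definition ln1p_coef (R : realType) (n : nat) : R :=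
  if n is m.+1 then (-1) ^+ m / m.+1%:R else 0.

Lemma norm_ln1p_coef (R : realType) n : `|ln1p_coef R n| <= 1.
Proof.
case: n => [|n] /=; first by rewrite normr0.
by rewrite normrM normrX normrN1 expr1n mul1r normfV normr_nat invf_le1// ler1n.
Qed.

Lemma is_cvg_norm_ln1p_coef (R : realType) (x : R) : 0 <= x < 1 ->
  cvgn (pseries (fun n => `|ln1p_coef R n|) x).
Proof.
move=> /andP[x0 x1].
have cg : cvgn (series (geometric 1 x)).
  by apply: is_cvg_geometric_series; rewrite ger0_norm.
apply: series_le_cvg cg => n //=.
- by rewrite mulr_ge0 ?exprn_ge0.
- by rewrite mul1r exprn_ge0.
- by rewrite ler_wpM2r ?exprn_ge0// norm_ln1p_coef.
Qed.

Lemma zero_derive_cst (R : realType) (h : R -> R) (r x : R) :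
  (forall y, `|y| < r -> is_derive y (1 : R) h 0) -> `|x| < r -> h x = h 0.
Proof.
move=> dh xr.
have cst a b : a < b -> `|a| < r -> `|b| < r -> h b = h a.
  move=> ab /ltr_normlP[a1 a2] /ltr_normlP[b1 b2].
  have inr y : y \in `[a, b] -> `|y| < r.
    by rewrite in_itv/= => /andP[? ?]; apply/ltr_normlP; split; lra.
  have [||c _] := @MVT R h (fun=> 0) a b ab.
  - by move=> y yab; apply: dh; apply: inr; exact: subset_itv_oo_cc.
  - apply: derivable_within_continuous => y /inr /dh h'.
    exact: ex_derive.
  - by rewrite mul0r => /eqP; rewrite subr_eq0 => /eqP.
have r0 : `|0 : R| < r by rewrite normr0 (le_lt_trans _ xr).
case: (ltgtP x 0) => [x0|x0|->//].
- by apply/esym/cst.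
- exact: cst.
Qed.

(** Both sides vanish at 0 and have derivative 1 / (1 + x), by the geometric
    series. The radius 1 / 32 is the radius 1 / 2 divided by 4 twice:
    termwise differentiation is justified where the second derived series
    still converges. *)
Lemma ln1p_pseries (R : realType) (x : R) : `|x| < 1 / 32 ->
  pseries (ln1p_coef R) x @ \oo --> ln (1 + x).
Proof.
move=> xr.
have c2 : cvgn (pseries (ln1p_coef R) (1 / 2)).
  apply: normed_cvg; rewrite /normed_series_of.
  rewrite (_ : (fun n => _) = (fun n => `|ln1p_coef R n| * (1 / 2) ^+ n)).
    by apply: is_cvg_norm_ln1p_coef; lra.
  by apply/funext => n; rewrite normrM (ger0_norm (exprn_ge0 _ _))//; lra.
have k2 : 0 < 1 / 2 :> R by rewrite divr_gt0.
have k8 : 0 < 1 / 2 / 4 :> R by rewrite divr_gt0.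
have c8 := is_cvg_pseries_diffs k2 c2.
have c32 := is_cvg_pseries_diffs k8 c8.
have cin (c : R^nat) (K : R) y : `|y| < 1 / 32 -> 1 / 32 <= K ->
    cvgn (pseries c K) -> cvgn (pseries c y).
  move=> yr Kr cK; apply: is_cvg_pseries_inside cK _.
  by rewrite (lt_le_trans yr)// (le_trans Kr)// ler_norm.
have q : 1 / 32 = 1 / 2 / 4 / 4 :> R by field.
pose S y := limn (pseries (ln1p_coef R) y).
have dS y : `|y| < 1 / 32 -> is_derive y (1 : R) S (1 + y)^-1.
  move=> yr.
  have -> : (1 + y)^-1 = limn (pseries (pseries_diffs (ln1p_coef R)) y).
    apply/esym/cvg_lim => //.
    rewrite (_ : pseries _ _ = series (geometric 1 (- y))).
      rewrite -[(1 + y)^-1]mul1r -[in X in _ --> X](opprK y).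
      by apply: cvg_geometric_series; rewrite normrN (lt_trans yr)//; lra.
    apply/funext => n; apply: eq_bigr => i _ /=.
    rewrite /pseries_diffs /ln1p_coef mulrCA divff ?mulr1; last first.
      by rewrite pnatr_eq0.
    by rewrite mul1r -exprMn mulN1r.
  apply: (@pseries_snd_diffs _ _ (1 / 32)).
  - apply: is_cvg_pseries_inside c2 _; rewrite !gtr0_norm; lra.
  - apply: is_cvg_pseries_inside c8 _; rewrite !gtr0_norm; lra.
  - by rewrite q.
  - by rewrite [ltRHS]gtr0_norm//; lra.
have dln y : `|y| < 1 / 32 ->
    is_derive y (1 : R) (fun y => ln (1 + y)) (1 + y)^-1.
  move=> /ltr_normlP[y1 y2].
  have y0 : 0 < 1 + y by lra.
  have d1 := is_derive1_ln y0.
  have d2 : is_derive y (1 : R) (fun y : R => 1 + y) 1.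
    have := is_deriveD (is_derive_cst (1 : R) y 1) (is_derive_id y (1 : R)).
    by rewrite add0r.
  by have := is_derive1_comp d1 d2; rewrite mulr1.
have S0 : S 0 = 0.
  apply/cvg_lim => //; rewrite (_ : pseries _ _ = fun=> 0); first exact: cvg_cst.
  apply/funext => n; rewrite /pseries/series/= big1_seq// => -[|i] _ /=.
    by rewrite mul0r.
  by rewrite expr0n mulr0.
have -> : ln (1 + x) = S x.
  have dB y : `|y| < 1 / 32 ->
      is_derive y (1 : R) (fun y => ln (1 + y) - S y) 0.
    move=> yr; have h1 := dln _ yr; have h2 := dS _ yr.
    by have := is_deriveB h1 h2; rewrite subrr.
  have := zero_derive_cst dB xr.
  by rewrite addr0 ln1 S0 subr0 => /eqP; rewrite subr_eq0 => /eqP.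
by apply: cin c2 => //; lra.
Qed.

Lemma rep_ln1p (R : realType) (u : R -> R) (rho M del : R) : 0 < rho ->
  0 < del -> M < 1 / 32 -> rep rho M del u ->
  exists K, rep rho K del (fun x => ln (1 + u x)).
Proof.
move=> r0 d0 M32 urep; have M0 := rep_norm_ge0 urep.
have /cvg_ex[/= K HK] : cvgn (pseries (fun n => `|ln1p_coef R n|) M).
  by apply: is_cvg_norm_ln1p_coef; lra.
exists K.
have := @rep_pseries R rho M del K u (fun x => ln (1 + u x)) 1 (ln1p_coef R)
  r0 d0 urep.
rewrite mul1r; apply => //; first by case.
move=> x xr; apply: ln1p_pseries; apply: le_lt_trans M32.
exact: rep_bound1 (ltW d0) urep xr.
Qed.
(** * Leading terms and the exponential form *)

Lemma seq_min (R : realType) (s : seq R) : s != [::] ->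
  exists2 m, m \in s & forall x, x \in s -> m <= x.
Proof.
elim: s => [//|a [|b s] IH] _.
  by exists a => [|x]; rewrite inE// => /eqP ->.
have [//|m ms mle] := IH; case: (leP a m) => am.
- exists a; first by rewrite inE eqxx.
  move=> x; rewrite inE => /predU1P[->//|/mle]; exact: le_trans.
- exists m; first by rewrite inE ms orbT.
  by move=> x; rewrite inE => /predU1P[->|/mle//]; exact: ltW.
Qed.

Lemma natural_set_min (R : realType) (A : set R) : natural_set A ->
  A !=set0 -> exists2 m, A m & forall a, A a -> m <= a.
Proof.
move=> nA [b Ab]; have /finite_seqP[s sE] := nA b.
have inS x : (A x /\ x <= b) <-> x \in s.
  by split=> [h|h]; [have : [set` s] x by rewrite -sE|
                     have : (A `&` [set x | x <= b]) x by rewrite sE].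
have [|m /inS[Am mb] mle] := @seq_min _ s.
  by apply/negP => /eqP s0; have /inS := conj Ab (lexx b); rewrite s0.
exists m => // a Aa; case: (leP a b) => ab; first by apply/mle/inS.
by rewrite (le_trans mb)// ltW.
Qed.

(** Naturality leaves a gap above any strict lower bound; this is where
    positive orders come from. *)
Lemma natural_set_gap (R : realType) (A : set R) (l : R) : natural_set A ->
  (forall a, A a -> l < a) ->
  exists2 del, 0 < del & forall a, A a -> l + del <= a.
Proof.
move=> nA lA; have [A0|/set0P/negP/negPn/eqP A0] := pselect (A !=set0).
- have [m Am mle] := natural_set_min nA A0.
  by exists (m - l) => [|a /mle]; [rewrite subr_gt0 lA|rewrite addrC subrK].
- by exists 1 => // a; rewrite A0.
Qed.

Lemma powR_small (R : realType) (c l e : R) : 0 < l -> 0 < e ->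
  exists2 x : R, 0 < x & c * x `^ l < e.
Proof.
move=> l0 e0.
have : c * x `^ l @[x --> 0^'+] --> c * 0.
  by apply: cvgM; [exact: cvg_cst|exact: powR_cvg0].
rewrite mulr0 => /cvgr0Pnorm_lt/(_ _ e0)/near0_rightP[x x0 /(_ x)].
rewrite x0 lexx => /(_ isT) h; exists x => //.
exact: le_lt_trans (ler_norm _) h.
Qed.

Lemma rep_small (R : realType) (rho M del e : R) (f : R -> R) : 0 < rho ->
  0 < del -> 0 < e -> rep rho M del f ->
  exists2 r, 0 < r <= rho & exists2 N, N < e & rep r N del f.
Proof.
move=> r0 d0 e0 frep; have M0 := rep_norm_ge0 frep.
have [x x0 xM] := powR_small M d0 e0.
pose r := rho * Num.min x 1.
have m0 : 0 < Num.min x 1 by rewrite lt_min x0 ltr01.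
have rr : 0 < r <= rho.
  by rewrite mulr_gt0//= ler_piMr ?(ltW r0)// ge_min lexx orbT.
exists r => //; exists ((r / rho) `^ del * M); last exact: rep_shrink.
rewrite /r mulrAC divff ?gt_eqF// mul1r; apply: le_lt_trans xM.
rewrite mulrC ler_wpM2l// ge0_ler_powR ?nnegrE ?(ltW d0) ?(ltW m0) ?(ltW x0)//.
by rewrite ge_min lexx.
Qed.

Lemma rep_cvg0 (R : realType) (rho M del : R) (f : R -> R) : 0 < rho ->
  0 < del -> rep rho M del f -> f x @[x --> 0^'+] --> 0.
Proof.
move=> r0 d0 frep; apply/cvgr0Pnorm_lt => e e0.
have [r /andP[r1 _] [N Ne rrep]] := rep_small r0 d0 e0 frep.
apply/near0_rightP; exists r => // x xr.
by apply: le_lt_trans Ne; apply: rep_bound1 rrep xr; exact: ltW.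
Qed.

Definition pos_small_germ (R : realType) (f : R -> R) :=
  (\forall x \near 0^'+, 0 < f x) /\ f x @[x --> 0^'+] --> 0.

(** The chart-free version of a log-free Dulac representation: log f is
    lam log x + c up to an expansion of positive order. *)
Definition has_exp_form (R : realType) (f : R -> R) :=
  exists lam c rho M del W, [/\ [/\ 0 < lam, 0 < rho & 0 < del],
    rep rho M del W &
    forall x : R, 0 < x <= rho -> f x = expR (lam * ln x + c + W x)].

(** The smallest exponent lam exists by naturality; U collects the remaining
    terms divided by the leading one, and its order is the gap above lam. *)
Lemma rep_leading_term (R : realType) (f : R -> R) (rho M : R) : 0 < rho ->
  rep rho M 0 f -> (exists2 x, 0 < x <= rho & f x != 0) ->
  exists lam c N del U, [/\ 0 <= lam, c != 0, 0 < del, rep rho N del U &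
    forall x : R, 0 < x <= rho -> f x = c * x `^ lam * (1 + U x)].
Proof.
move=> r0 [F [Fn Fd FM Fh]] [x0 x0r fx0].
have [lam Flam lamle] : exists2 m, coef_support F m &
    forall a, coef_support F a -> m <= a.
  apply: natural_set_min => //; apply/set0P/negP => /eqP F0.
  move/eqP: fx0; apply; apply: hasum_unique (Fh _ x0r) _.
  have := hasumZ 0 (Fh _ x0r); rewrite mul0r; apply: eq_hasum => a _.
  rewrite mul0r; have [->|Fa] := eqVneq (F a) 0; first by rewrite mul0r.
  by have : coef_support F a := Fa; rewrite F0.
pose A := coef_support F `\ lam.
have [del del0 gap] : exists2 del, 0 < del & forall a, A a -> lam + del <= a.
  apply: natural_set_gap.
    by move=> B; apply: sub_finite_set (Fn B) => a [[? _] ?].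
  move=> a [Fa /eqP alam]; rewrite lt_neqAle lamle// andbT.
  by rewrite eq_sym.
pose F' a := if a == lam then 0 else F a.
have F'E a : F' a != 0 -> A a.
  rewrite /F'; case: (eqVneq a lam) => [_|alam Fa]; first by rewrite eqxx.
  by split => //; exact/eqP.
have F'rep : rep rho M (lam + del) (fun x => f x - F lam * x `^ lam).
  exists F'; split.
  - by move=> B; apply: sub_finite_set (Fn B) => a [/F'E[? _] ?].
  - by move=> a /F'E /gap.
  - apply: le_trans FM; apply: le_esum => a _; rewrite lee_fin.
    rewrite ler_wpM2r ?powR_ge0// /F'; case: ifP => // _.
    by rewrite normr0.
  - move=> x /Fh Fx.
    have := @hasum_set1 R R lam
      (fun a => if a == lam then F lam * x `^ lam else 0).
    move=> /(_ _)/(hasumZ (-1))/(hasumD Fx); rewrite eqxx mulN1r.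
    move=> h; apply: eq_hasum (h _) => [a _|a /negPf ->//].
    rewrite /F'; case: (eqVneq a lam) => [->|_].
      by rewrite mul0r mulN1r subrr.
    by rewrite mulr0 addr0.
have Urep := rep_shift (F lam)^-1 (- lam) r0 F'rep.
rewrite addrA addNr add0r in Urep.
exists lam, (F lam); do 3 eexists.
split; [|exact: Flam|exact: del0|exact: Urep|].
  exact: Fd.
move=> x /andP[xg0 _].
have xl : x `^ lam != 0 by rewrite gt_eqF// powR_gt0.
have Fl : F lam != 0 := Flam.
by rewrite powRN; field; rewrite xl.
Qed.

(** On a small interval U is less than 1 / 32 in norm, so log(1 + U) expands.
    Positivity of f forces the leading coefficient to be positive, and f -> 0
    excludes the exponent 0. *)
Lemma gps_exp_form (R : realType) (f : R -> R) :
  has_gps_representation f -> pos_small_germ f -> has_exp_form f.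
Proof.
move=> /gps_rep[rho [M [r0 frep]]] [/near0_rightP[e e0 fpos] f0].
have ex : exists2 x, 0 < x <= rho & f x != 0.
  exists (Num.min rho e); first by rewrite lt_min r0 e0/= ge_min lexx.
  by rewrite gt_eqF// fpos// lt_min r0 e0/= ge_min lexx orbT.
have [lam [c [N [del [U [lam0 c0 d0 Urep fE]]]]]] :=
  rep_leading_term r0 frep ex.
have [|r /andP[rg0 rrho] [N' N'32 U'rep]] :=
  @rep_small _ _ _ _ (1 / 32) _ r0 d0 _ Urep.
  by rewrite divr_gt0.
have Ub x : 0 < x <= r -> 31 / 32 < 1 + U x.
  move=> xr; have := rep_bound1 (ltW d0) U'rep xr.
  by move=> /(le_lt_trans)/(_ N'32)/ltr_normlP[? ?]; lra.
have fEr x : 0 < x <= r -> f x = c * x `^ lam * (1 + U x).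
  by move=> /andP[x0 xr]; rewrite fE// x0/= (le_trans xr).
have cpos : 0 < c.
  pose x := Num.min r e.
  have xr : 0 < x <= r by rewrite lt_min rg0 e0/= ge_min lexx.
  have xe : 0 < x <= e by rewrite lt_min rg0 e0/= ge_min lexx orbT.
  have := fpos _ xe; rewrite fEr// pmulr_lgt0; last by have := Ub _ xr; lra.
  by rewrite pmulr_lgt0// powR_gt0//; case/andP: xr.
have lampos : 0 < lam.
  rewrite lt_neqAle lam0 andbT; apply/eqP => l0.
  have [|s s0 fs] := (near0_rightP (fun x => `|f x| < c / 2)).1.
    by apply: cvgr0_norm_lt => //; rewrite divr_gt0.
  pose x := Num.min r s.
  have xr : 0 < x <= r by rewrite lt_min rg0 s0/= ge_min lexx.
  have xs : 0 < x <= s by rewrite lt_min rg0 s0/= ge_min lexx orbT.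
  have := fs _ xs; rewrite fEr// -l0 powRr0 mulr1; have := Ub _ xr.
  move=> Ux; rewrite gtr0_norm ?mulr_gt0//; last by lra.
  by rewrite ltr_pM2l//; lra.
have [K Wrep] := rep_ln1p rg0 d0 N'32 U'rep.
exists lam, (ln c), r, K, del, (fun x => ln (1 + U x)); split => // x xr.
have x0 : 0 < x by case/andP: xr.
have U0 : 0 < 1 + U x by have := Ub _ xr; lra.
rewrite !expRD !lnK ?posrE// fEr// /powR gt_eqF//.
by rewrite [c * _]mulrC.
Qed.

Lemma exp_form_rep (R : realType) (f : R -> R) : has_exp_form f ->
  exists lam rho M, [/\ 0 < lam, 0 < rho & rep rho M lam f].
Proof.
move=> [lam [c [rho [M [del [W [[lam0 r0 d0] Wrep fE]]]]]]].
have frep := rep_shift (expR c) lam r0 (rep_expR r0 d0 Wrep).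
exists lam, rho; eexists; split => //.
apply: rep_weaken frep; [exact: lexx|by rewrite addr0|].
move=> x /[dup] xr /andP[x0 _]; rewrite fE// !expRD /powR gt_eqF//.
by rewrite [expR c * _]mulrC.
Qed.

(** Expand d(g(x)) = sum_a F_a g(x)^a, where
    g(x)^a = e^(c a) x^(lam a) exp(a W(x)) has norm at most
    (e^c rho^lam e^N)^a; the radius rho is chosen so that this base is at most
    the radius r of d. Orders lam a tend to infinity along the support of d. *)
Lemma gps_comp_exp_form (R : realType) (d g : R -> R) :
  has_gps_representation d -> has_exp_form g -> has_gps_representation (d \o g).
Proof.
move=> /gps_rep[r [M [r0 [F [Fn Fd FM Fh]]]]].
move=> [lam [c [rho0 [N [del [W [[lam0 rho00 d0] Wrep0 gE0]]]]]]].
have [y y0 yr] := powR_small (expR (c + N)) lam0 r0.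
pose rho := Num.min rho0 y.
have rhog0 : 0 < rho by rewrite lt_min rho00.
have rr : 0 < rho <= rho0 by rewrite rhog0/= ge_min lexx.
have Wrep := rep_shrink0 (ltW d0) rr Wrep0.
have gE x : 0 < x <= rho -> g x = expR c * x `^ lam * expR (W x).
  move=> /andP[x0 xr]; rewrite gE0; last first.
    by rewrite x0/= (le_trans xr)//; case/andP: rr.
  by rewrite !expRD /powR gt_eqF// [expR c * _]mulrC.
have base : expR c * rho `^ lam * expR N <= r.
  rewrite mulrAC -expRD; apply: le_trans (ltW yr).
  rewrite ler_wpM2l ?expR_ge0// ge0_ler_powR ?nnegrE ?(ltW lam0)
    ?(ltW rhog0) ?(ltW y0)//.
  by rewrite ge_min lexx orbT.
have gr x : 0 < x <= rho -> 0 < g x <= r.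
  move=> xr; rewrite gE//; have x0 : 0 < x by case/andP: xr.
  rewrite !mulr_gt0 ?expR_gt0 ?powR_gt0//=; apply: le_trans base.
  rewrite ler_pM ?mulr_ge0 ?expR_ge0 ?powR_ge0//.
    rewrite ler_wpM2l ?expR_ge0// ge0_ler_powR ?nnegrE ?(ltW lam0)
      ?(ltW rhog0) ?(ltW x0)//.
    by case/andP: xr.
  rewrite ler_expR; apply: le_trans (ler_norm _) _.
  exact: rep_bound1 (ltW d0) Wrep xr.
apply: (@rep_gps _ _ rho M 0) => //.
apply: (@rep_sum _ _ (coef_support F) (fun a x => F a * g x `^ a)
   (fun a => `|F a| * (expR c * rho `^ lam * expR N) `^ a)
   (fun a => lam * a)) => //.
- move=> a /Fd a0.
  have aW : rep rho (a * N) del (fun x => a * W x).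
    by have := rep_scale a rhog0 Wrep; rewrite ger0_norm.
  have := rep_shift (F a * expR c `^ a) (lam * a) rhog0 (rep_expR rhog0 d0 aW).
  have expM z : expR (a * z) = expR z `^ a.
    by rewrite /powR gt_eqF ?expR_gt0// expRK.
  apply: rep_weaken.
  + rewrite normrM (ger0_norm (powR_ge0 _ _)) expM powRrM -!mulrA.
    by rewrite -!powRM ?mulr_ge0 ?powR_ge0 ?expR_ge0.
  + by rewrite addr0.
  + move=> x /gE ->; rewrite expM powRrM -!mulrA.
    by rewrite -!powRM ?mulr_ge0 ?powR_ge0 ?expR_ge0.
- apply: le_trans FM; rewrite esum_mkcond; apply: le_esum => a _.
  case: ifPn => [/set_mem Fa|_]; last first.
    by rewrite lee_fin mulr_ge0 ?powR_ge0.
  rewrite lee_fin ler_wpM2l// ge0_ler_powR ?Fd ?nnegrE ?(ltW r0)//.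
  by rewrite !mulr_ge0 ?expR_ge0 ?powR_ge0.
- move=> B; rewrite (_ : [set a | _] = [set a | a <= B / lam]); first exact: Fn.
  by apply/seteqP; split => a /=; rewrite ler_pdivlMr// mulrC.
- by move=> a /Fd a0; rewrite mulr_ge0// ltW.
- move=> x /gr /Fh Fx; apply/hasum_supported => //.
  by move=> a /negP/negPn/eqP ->; rewrite mul0r.
Qed.
(** * Composition of germs at the right of zero *)

Lemma near_right_comp (R : realType) (g : R -> R) (P : R -> Prop) :
  pos_small_germ g ->
  (\forall y \near 0^'+, P y) -> \forall x \near 0^'+, P (g x).
Proof.
move=> [gpos g0] /near0_rightP[e e0 He]; near=> x; apply: He.
have gx : 0 < g x by near: x.
rewrite gx/= -[leLHS]gtr0_norm//; near: x.
exact: (cvgr0_norm_le _ g0).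
Unshelve. all: by end_near. Qed.

Lemma pos_small_germ_comp (R : realType) (f g : R -> R) :
  pos_small_germ f -> pos_small_germ g -> pos_small_germ (f \o g).
Proof.
move=> [fpos f0] gps; split; first exact: (near_right_comp gps fpos).
apply/cvgr0Pnorm_lt => e e0.
exact: (near_right_comp gps (cvgr0_norm_lt _ f0 _ e0)).
Qed.

Lemma pos_small_germ_near (R : realType) (f g : R -> R) :
  (\forall x \near 0^'+, f x = g x) -> pos_small_germ f -> pos_small_germ g.
Proof.
move=> fg [fpos f0]; split; last exact: cvg_trans (near_eq_cvg fg) f0.
near=> x; rewrite -(_ : f x = g x); first by near: x.
by near: x.
Unshelve. all: by end_near. Qed.

Lemma near0_right (R : realType) (P : R -> Prop) :
  (\forall x \near (0 : R), P x) -> \forall x \near 0^'+, P x.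
Proof.
move=> /near0P[e e0 He]; apply/near0_rightP; exists (e / 2).
  by rewrite divr_gt0.
move=> x /andP[x0 xe]; apply: He; rewrite gtr0_norm// (le_lt_trans xe)//.
by rewrite ltr_pdivrMr// ltr_pMr// ltr1n.
Qed.

Lemma has_gps_comp (R : realType) (f g : R -> R) :
  has_gps_representation f -> has_gps_representation g -> pos_small_germ g ->
  has_gps_representation (f \o g).
Proof.
by move=> fgps ggps gsm; exact/(gps_comp_exp_form fgps)/gps_exp_form.
Qed.

(** * Analytic diffeomorphism germs *)

(** The power series of f, read as an expansion in the powers x^n for x > 0,
    has order at least 1 since f(0) = 0. *)
Lemma analytic_germ (R : realType) (f : R -> R) : f 0 = 0 ->
  analytic_at f 0 ->
  [/\ has_gps_representation f, f x @[x --> 0^'+] --> 0 & derivable f 0 1].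
Proof.
move=> f0 [a /near0P[e e0 aE]].
have {}aE x : `|x| < e -> pseries a x @ \oo --> f x.
  by move=> /aE; rewrite subr0.
pose K := e / 2.
have K0 : 0 < K by rewrite divr_gt0.
have Ke : `|K| < e by rewrite gtr0_norm// ltr_pdivrMr// ltr_pMr// ltr1n.
have cK : cvgn (pseries a K) by apply: cvgP (aE _ Ke).
have a0 : a 0%N = 0.
  have h := aE 0; rewrite normr0 f0 in h.
  have c0 : [sequence pseries a 0 n.+1]_n @ \oo --> a 0%N.
    rewrite (_ : [sequence _]_n = fun=> a 0%N); first exact: cvg_cst.
    apply/funext => n; rewrite /pseries/series/= big_nat_recl// expr0 mulr1.
    by rewrite big1_seq ?addr0// => i _; rewrite expr0n mulr0.
  rewrite (cvg_shiftS (pseries a 0)) in c0.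
  exact: (cvg_unique _ c0 (h e0)).
have rho0 : 0 < K / 2 by rewrite divr_gt0.
have rK : `|K / 2| < `|K|.
  by rewrite !gtr0_norm// ltr_pdivrMr// ltr_pMr// ltr1n.
have /cvg_ex[/= N HN] := is_cvg_pseries_inside_norm cK rK.
(* f is the substitution of the identity into its own power series *)
have idrep : rep (K / 2) (K / 2) 1 (fun x => x).
  apply: rep_weaken (rep_monomial 1 1 rho0).
  - by rewrite normr1 mul1r powRr1// ltW.
  - exact: lexx.
  - by move=> x /andP[x0 _]; rewrite mul1r powRr1// ltW.
have frep : rep (K / 2) N (1%:R * 1) f.
  apply: (rep_pseries rho0 ltr01 idrep _ HN); first by case.
  move=> x /andP[x0 xK]; apply: aE; rewrite gtr0_norm// (le_lt_trans xK)//.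
  by move: rK Ke; rewrite !gtr0_norm//; exact: lt_trans.
rewrite mulr1 in frep.
split.
- by apply: rep_gps frep => //; exact: ler01.
- exact: rep_cvg0 frep.
have c4 := is_cvg_pseries_diffs K0 cK.
have K4 : 0 < K / 4 by rewrite divr_gt0.
have c16 := is_cvg_pseries_diffs K4 c4.
have K16 : 0 < K / 4 / 4 by rewrite divr_gt0.
have dS : is_derive (0 : R) (1 : R) (fun x => limn (pseries a x))
    (limn (pseries (pseries_diffs a) 0)).
  apply: (@pseries_snd_diffs _ _ (K / 4 / 4)) => //.
  - apply: is_cvg_pseries_inside cK _; rewrite !gtr0_norm//; lra.
  - apply: is_cvg_pseries_inside c4 _; rewrite !gtr0_norm//; lra.
  - by rewrite normr0 normr_gt0 gt_eqF.
apply: near_eq_derivable (@ex_derive _ _ _ _ _ _ _ dS).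
apply/near0P; exists e => // x /aE h; exact: (cvg_lim _ h).
Qed.

Lemma orientation_sign (R : realType) (f : R -> R) : f 0 = 0 ->
  derivable f 0 1 -> orientation_preserving_at0 f ->
  \forall x \near (0 : R), (0 < x -> 0 < f x) /\ (x < 0 -> f x < 0).
Proof.
move=> f0 df; rewrite /orientation_preserving_at0 derive1E => fpos.
have [e /= e0 He] := cvgr_gt _ df _ fpos.
 apply/near0P; exists e => // x xe.
have h : x != 0 -> 0 < x^-1 * f x.
  move=> xn0; have := He x; rewrite /ball/= sub0r normrN => /(_ xe xn0).
  by rewrite addr0 f0 subr0 /GRing.scale/= mulr1.
split => x0.
- by have := h (lt0r_neq0 x0); rewrite pmulr_rgt0// invr_gt0.
- have := h (ltr0_neq0 x0); rewrite nmulr_rgt0// invr_lt0//.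
Qed.

(** The sign of phi near 0 is that of its argument, which gives positivity of
    phi, and also of its inverse: for y > 0 the point g(y) can be neither
    negative nor 0 as phi(g(y)) = y. The function phiV is only an inverse as a
    germ; it coincides near 0 with the analytic inverse g, because
    phiV(y) = phiV(phi(g(y))) = g(y). *)
Lemma diffeo_small_gps_germ (R : realType) (phi phiV : R -> R) :
  analytic_diffeo_germ phi -> orientation_preserving_at0 phi ->
  inverse_germs_at0 phi phiV ->
  (has_gps_representation phi /\ pos_small_germ phi) /\
  (has_gps_representation phiV /\ pos_small_germ phiV).
Proof.
move=> [p0 pan [g [g0 gan [gp pg]]]] por [vp pv].
have [pgps pcvg pder] := analytic_germ p0 pan.
have [ggps gcvg gder] := analytic_germ g0 gan.
have psign := orientation_sign p0 pder por.
have gcont : g x @[x --> (0 : R)] --> (0 : R).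
  rewrite -[X in _ --> X]g0.
  exact/differentiable_continuous/derivable1_diffP.
have pull (P : R -> Prop) : (\forall x \near (0 : R), P x) ->
    \forall y \near (0 : R), P (g y).
  by move=> h; exact: (gcont _ h).
have pos0 : \forall x \near (0 : R)^'+, 0 < x by exact: nbhs_right_gt.
split.
  split => //; split => //; near=> x.
  have [h _] : (0 < x -> 0 < phi x) /\ (x < 0 -> phi x < 0).
    by near: x; exact: near0_right.
  by apply: h; near: x.
have gE : \forall y \near 0^'+, g y = phiV y.
  near=> y.
  have e1 : phi (g y) = y by near: y; exact: near0_right pg.
  have e2 : phiV (phi (g y)) = g y by near: y; exact/near0_right/(pull _ vp).
  by rewrite -e2 e1.
split; first exact: has_gps_near gE ggps.
apply: pos_small_germ_near gE _; split => //; near=> y.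
have y0 : 0 < y by near: y.
have e1 : phi (g y) = y by near: y; exact: near0_right pg.
have [_ hneg] : (0 < g y -> 0 < phi (g y)) /\ (g y < 0 -> phi (g y) < 0).
  by near: y; exact/near0_right/(pull _ psign).
rewrite e1 in hneg; case: (ltgtP (g y) 0) => // [/hneg|gy0].
- by rewrite ltNge (ltW y0).
- by move: y0; rewrite -e1 gy0 p0 ltxx.
Unshelve. all: by end_near. Qed.

(** * The logarithmic chart *)

Lemma near_pinfty_expR (R : realType) (P : R -> Prop) :
  (\forall z \near +oo, P (expR (- z))) <-> \forall x \near 0^'+, P x.
Proof.
split.
- move=> [Z [_ HZ]]; apply/near0_rightP; exists (expR (- (Z + 1))).
    exact: expR_gt0.
  move=> x /andP[x0 xe]; have := HZ (- ln x).
  rewrite opprK lnK ?posrE//; apply; rewrite ltrNr.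
  rewrite -[X in _ < X]expRK ltr_ln ?posrE ?expR_gt0//.
  by apply: le_lt_trans xe _; rewrite ltr_expR; lra.
- move=> /near0_rightP[e e0 He]; near=> z; apply: He.
  rewrite expR_gt0/= -[leRHS]lnK ?posrE// ler_expR lerNl.
  by near: z; apply: nbhs_pinfty_ge; rewrite num_real.
Unshelve. all: by end_near. Qed.

(** With x = exp(-z), the identity -log f(x) = lam z + c + L(x) reads
    f(x) = exp(lam log x - c - L(x)); a series with zero constant term has
    positive order because its support is natural. *)
Lemma dulac_exp_form (R : realType) (f : R -> R) :
  (\forall x \near 0^'+, 0 < f x) ->
  has_dulac_representation (log_chart f) <-> has_exp_form f.
Proof.
move=> fpos; split.
- move=> [lam [c [L [lam0 Lc L0 fL]]]].
  have [r [M [r0 [Ln Ld LM Lh]]]] := gps_fun_represents Lc.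
  have [del d0 gap] : exists2 del, 0 < del &
      forall a, coef_support L a -> 0 + del <= a.
    apply: natural_set_gap => // a La.
    rewrite lt_neqAle Ld// andbT; apply: contra_neq La => <-.
    exact: L0.
  have Lrep : rep r M del (gps_fun L).
    exists L; split => //.
    by move=> a La; have := gap _ La; rewrite add0r.
  have /near0_rightP[e e0 fE] : \forall x \near 0^'+,
      f x = expR (lam * ln x + - c + - 1 * gps_fun L x).
    have fL' : \forall x \near 0^'+,
        - ln (f x) = lam * - ln x + c + gps_fun L x.
      apply/near_pinfty_expR; apply: filterS fL => z.
      by rewrite /log_chart expRK opprK.
    near=> x; have f0 : 0 < f x by near: x.
    rewrite -[LHS]lnK ?posrE//; congr expR.
    suff : - ln (f x) = lam * - ln x + c + gps_fun L x by lra.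
    by near: x.
  have rr : 0 < Num.min r e <= r by rewrite lt_min r0 e0/= ge_min lexx.
  have rg0 : 0 < Num.min r e by case/andP: rr.
  exists lam, (- c), (Num.min r e), (`|-1| * M), del.
  exists (fun x => - 1 * gps_fun L x).
  split => //; first exact: rep_scale (rep_shrink0 (ltW d0) rr Lrep).
  by move=> x /andP[x0]; rewrite le_min => /andP[_ xe]; rewrite fE// x0.
- move=> [lam [c [rho [M [del [W [[lam0 r0 d0] Wrep fE]]]]]]].
  have [L [Lc Ld LE]] := rep_gps_fun r0 (ltW d0) (rep_scale (-1) r0 Wrep).
  exists lam, (- c), L; split => //.
    by apply/eqP/negPn/negP => /Ld; rewrite leNgt d0.
  have fL : \forall x \near 0^'+, - ln (f x) = lam * - ln x + - c + gps_fun L x.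
    apply/near0_rightP; exists rho => // x xr.
    by rewrite fE// expRK -LE//; ring.
  move/near_pinfty_expR: fL; apply: filterS => z.
  by rewrite /log_chart expRK opprK.
Unshelve. all: by end_near. Qed.

(** dt = psi o d o phiV and, conversely, d = psi^-1 o dt o phi as germs. *)
Lemma gps_conjugate (R : realType) (d phi phiV psi dt : R -> R) :
  pos_small_germ d ->
  analytic_diffeo_germ phi -> orientation_preserving_at0 phi ->
  analytic_diffeo_germ psi -> orientation_preserving_at0 psi ->
  inverse_germs_at0 phi phiV ->
  (\forall x \near 0^'+, dt x = psi (d (phiV x))) ->
  pos_small_germ dt /\
  (has_gps_representation d <-> has_gps_representation dt).
Proof.
move=> dsm phid phio psid psio phiVi dtE.
have [[phigps phism] [phiVgps phiVsm]] := diffeo_small_gps_germ phid phio phiVi.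
have [_ _ [psiV [_ _ psiVi]]] := psid.
have [[psigps psism] [psiVgps psiVsm]] := diffeo_small_gps_germ psid psio psiVi.
have dtE' : \forall x \near 0^'+, (psi \o (d \o phiV)) x = dt x.
  by apply: filterS dtE => x ->.
have dtsm : pos_small_germ dt.
  apply: pos_small_germ_near dtE' _.
  exact: pos_small_germ_comp psism (pos_small_germ_comp dsm phiVsm).
split => //; split => [dgps|dtgps].
- apply: has_gps_near dtE' _.
  apply: has_gps_comp (pos_small_germ_comp dsm phiVsm) => //.
  exact: has_gps_comp.
- apply: has_gps_near (has_gps_comp psiVgps (has_gps_comp dtgps phigps phism)
    (pos_small_germ_comp dtsm phism)).
  have [e2 _] := phiVi; have [e3 _] := psiVi.
  have e1 := near_right_comp phism dtE.
  have e3' := near_right_comp dsm (near0_right e3).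
  near=> y.
  rewrite /= (_ : dt (phi y) = psi (d (phiV (phi y)))); last by near: y.
  rewrite (_ : phiV (phi y) = y); last by near: y; exact: near0_right.
  by near: y.
Unshelve. all: by end_near. Qed.

Lemma gps_dulac (R : realType) (f : R -> R) : pos_small_germ f ->
  has_gps_representation f <-> has_dulac_representation (log_chart f).
Proof.
move=> fsm; have [fpos _] := fsm.
have [dulac_exp exp_dulac] := dulac_exp_form fpos.
split => [fgps|/dulac_exp/exp_form_rep[lam [rho [M [lam0 r0 frep]]]]].
- exact/exp_dulac/gps_exp_form.
- exact: rep_gps (ltW lam0) frep.
Qed.

Unset Implicit Arguments.
Set Strict Implicit.

Theorem theorem6p3 (R : realType) (eps eps' : R) (d phi phiV psi dt : R -> R)
  (eps_gt0 : 0 < eps) (eps'_gt0 : 0 < eps')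
  (d_range : forall x : R, 0 < x < eps -> 0 < d x < eps')
  (d_cvg0 : d x @[x --> 0^'+] --> 0)
  (phi_diffeo : analytic_diffeo_germ phi)
  (phi_orient : orientation_preserving_at0 phi)
  (psi_diffeo : analytic_diffeo_germ psi)
  (psi_orient : orientation_preserving_at0 psi)
  (phiV_inverse : inverse_germs_at0 phi phiV)
  (dt_def : \forall x \near 0^'+, dt x = psi (d (phiV x))) :
  [<-> has_gps_representation d;
       has_gps_representation dt;
       has_dulac_representation (log_chart d);
       has_dulac_representation (log_chart dt)].
Proof.
have dsm : pos_small_germ d.
  split => //; apply/near0_rightP; exists (eps / 2); first by rewrite divr_gt0.
  move=> x /andP[x0 xe]; have /andP[//] : 0 < d x < eps'.
  apply: d_range; rewrite x0/= (le_lt_trans xe)//.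
  by rewrite ltr_pdivrMr// ltr_pMr// ltr1n.
have [dtsm ddt] := gps_conjugate dsm phi_diffeo phi_orient
  psi_diffeo psi_orient phiV_inverse dt_def.
have dD := gps_dulac dsm; have dtD := gps_dulac dtsm.
tfae; tauto.
Qed.
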